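(* Let $R$ be a commutative ring, $M$ an $R$-module and $T$ a non-empty subset of $\mathrm{Spec}(M)$. If $G(\tau_T)$ is a tree, then $G(\tau_T)$ is a star graph.
   Context: Rings are commutative with non-zero identity and modules are unital. $N<M$ means $N$ is a proper submodule of $M$. $(N:M)=\{r\in R: rM\subseteq N\}$. A prime submodule of $M$ is a submodule $P\neq M$ such that $re\in P$ ($r\in R$, $e\in M$) implies $r\in(P:M)$ or $e\in P$. $\mathrm{Spec}(M)$ is the set of prime submodules of $M$, and $V(N)=\{P\in\mathrm{Spec}(M): (P:M)\supseteq (N:M)\}$ for a submodule $N$ of $M$. $G(\tau_T)$ is the undirected graph with vertex set $\{N<M : \text{there exists } K<M \text{ with } V(N)\cup V(K)=T \text{ and } V(N),V(K)\neq T\}$, where distinct vertices $N,L$ are adjacent if and only if $V(N)\cup V(L)=T$. Graphs have non-empty vertex set by definition. A star graph is a complete bipartite graph $K_{1,m}$ with one part a singleton ($m$ may be infinite). *)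

(* Defs.v *)
From HB Require Import structures.
From mathcomp Require Import all_boot all_algebra.
From mathcomp Require Import boolp classical_sets.

Set Implicit Arguments.
Unset Strict Implicit.
Unset Printing Implicit Defensive.

Import GRing.Theory.
Local Open Scope classical_set_scope.
Local Open Scope ring_scope.

(* Simple undirected graphs, possibly infinite, whose vertices form a subset of
   [A]; [A] is a choiceType only so that [path], [cycle] and [uniq] apply. *)
Record sgraph (A : choiceType) := SGraph {
  vert : set A;
  adj : A -> A -> Prop;
  adj_vert : forall x y, adj x y -> vert x;
  adj_sym : forall x y, adj x y -> adj y x;
  adj_irrefl : forall x, ~ adj x x }.

Section GraphTheory.
Variables (A : choiceType) (G : sgraph A).

Definition adjb : rel A := fun x y => `[< adj G x y >].

Definition graph_connected : Prop :=
  forall x y, vert G x -> vert G y -> exists2 p, path adjb x p & last x p = y.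

(* The length bound excludes the closed walks x, y, x along a single edge. *)
Definition graph_acyclic : Prop :=
  ~ exists c : seq A, (3 <= size c)%N /\ ucycle adjb c.

(* A graph is required to have a vertex, but [sgraph] does not enforce it. *)
Definition is_tree : Prop :=
  [/\ vert G !=set0, graph_connected & graph_acyclic].

Definition complete_bipartite (X Y : set A) : Prop :=
  [/\ X !=set0, Y !=set0, X `&` Y = set0, vert G = X `|` Y
    & forall x y, adj G x y <-> (X x /\ Y y) \/ (Y x /\ X y)].

Definition is_star : Prop :=
  exists (c : A) (Y : set A), complete_bipartite [set c] Y.

End GraphTheory.

Section PrimeSpectrum.
Variables (R : comNzRingType) (M : lmodType R).
Implicit Types (N K P : set M) (T : set (set M)).

Definition submodule N : Prop := submod_closed (mem N).

Definition proper_submodule N : Prop := submodule N /\ N <> setT.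

Definition colon N : set R := [set r | forall m : M, N (r *: m)].

Definition prime_submodule P : Prop :=
  proper_submodule P /\
  forall (r : R) (e : M), P (r *: e) -> colon P r \/ P e.

Definition Spec : set (set M) := [set P | prime_submodule P].

Definition V N : set (set M) := [set P | Spec P /\ colon N `<=` colon P].

Definition tau_vertex T : set (set M) :=
  [set N | proper_submodule N /\
     exists K, [/\ proper_submodule K, V N `|` V K = T, V N <> T & V K <> T]].

Definition tau_adj T N L : Prop :=
  [/\ tau_vertex T N, tau_vertex T L, N <> L & V N `|` V L = T].

Lemma tau_adj_vert T N L : tau_adj T N L -> tau_vertex T N.
Proof. by case. Qed.

Lemma tau_adj_sym T N L : tau_adj T N L -> tau_adj T L N.
Proof.
by case=> vN vL NL VT; split=> //; [exact: nesym | rewrite setUC].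
Qed.

Lemma tau_adj_irrefl T N : ~ tau_adj T N N.
Proof. by case. Qed.

Definition G_tau T : sgraph (set M) :=
  SGraph (@tau_adj_vert T) (@tau_adj_sym T) (@tau_adj_irrefl T).

End PrimeSpectrum.

Arguments Spec {R} M.

(* Main.v *)
Require Import Defs.
From mathcomp Require Import all_boot all_algebra.
From mathcomp Require Import boolp classical_sets.
Local Open Scope classical_set_scope.

(** Suppose that a tree [G_tau T] contains a path N - L - K - H.  Since
    V(N `&` H) = V(N) `|` V(H), either V(N) `|` V(H) = T and the path closes up
    to a 4-cycle, or N `&` H is a vertex adjacent to both L and K, which gives
    a triangle.  A tree with an edge and no path on four vertices is a star. *)

Import GRing.Theory.

Section Graphs.
Set Implicit Arguments.
Unset Strict Implicit.
Variables (A : choiceType) (G : sgraph A).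

Lemma adj_neq x y : adj G x y -> x != y.
Proof. by move=> xy; apply/eqP => e; move: xy; rewrite e; exact: adj_irrefl. Qed.

Lemma acyclic_no_triangle x y z :
  graph_acyclic G -> adj G x y -> adj G y z -> adj G z x -> False.
Proof.
move=> acG xy yz zx; apply: acG; exists [:: x; y; z]; split=> //.
apply/andP; split.
  by rewrite /= andbT; apply/and3P; split; apply/asboolP.
rewrite /= !inE negb_or (adj_neq xy) (adj_neq yz) eq_sym.
by rewrite (adj_neq zx).
Qed.

Lemma acyclic_no_square x y z t : graph_acyclic G ->
  adj G x y -> adj G y z -> adj G z t -> adj G t x -> x <> z -> y <> t -> False.
Proof.
move=> acG xy yz zt tx /eqP xz /eqP yt.
apply: acG; exists [:: x; y; z; t]; split=> //.
apply/andP; split.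
  by rewrite /= andbT; apply/and4P; split; apply/asboolP.
rewrite /= !inE !negb_or (adj_neq xy) (adj_neq yz) (adj_neq zt) xz yt.
by rewrite eq_sym (adj_neq tx).
Qed.

(** Turns connectedness into an induction principle: in a connected graph, a set that contains a
    vertex and is closed under adjacency contains every vertex. *)
Lemma path_closed (S : set A) x p : path (adjb G) x p ->
  S x -> (forall y z, S y -> adj G y z -> S z) -> S (last x p).
Proof.
move=> xp Sx Scl; elim: p x xp Sx => //= y p IHp x /andP[/asboolP xy yp] Sx.
exact/IHp/(Scl x).
Qed.

(** The hypothesis on [c] makes [c] together with its neighbours closed under adjacency, so by
    connectedness this is the whole vertex set, and every edge must meet [c]. *)
Lemma star_of_center c b : is_tree G -> adj G c b ->
  (forall y z, adj G c y -> adj G y z -> z = c) -> is_star G.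
Proof.
move=> [_ conG acG] cb cen; exists c, (adj G c); split.
- by exists c.
- by exists b.
- by apply/seteqP; split=> // y [-> /adj_irrefl].
- apply/seteqP; split=> [y vy|y [->|/adj_sym/adj_vert //]]; last exact: adj_vert cb.
  have [p cp <-] := conG _ _ (adj_vert cb) vy.
  apply: (path_closed cp); first by left.
  by move=> u v [->|cu] uv; [right | left; exact: cen uv].
- move=> x y; split=> [xy|[[-> //]|[cx ->]]]; last exact: adj_sym.
  have vx := adj_vert xy.
  have [p cp px] := conG _ _ (adj_vert cb) vx.
  have [xc|cx] : ([set c] `|` adj G c) x.
    rewrite -px; apply: (path_closed cp); first by left.
    by move=> u v [->|cu] uv; [right | left; exact: cen uv].
  + by left; split=> //; rewrite -xc.
  + by right; split=> //; exact: cen xy.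
Qed.

(** The centre is [a] if it has a neighbour other than [b], and [b] otherwise. The excluded walks
    may have [x = t], so triangles are covered too. *)
Lemma star_of_no_path4 a b : is_tree G -> adj G a b ->
  (forall x y z t, adj G x y -> adj G y z -> adj G z t ->
     x <> z -> y <> t -> False) -> is_star G.
Proof.
move=> tG ab noP4.
have [[c [ac cb]]|onlyb] := pselect (exists c, adj G a c /\ c <> b).
  apply: (star_of_center tG ab) => y z ay yz; apply: contrapT => za.
  have [yb|yb] := pselect (y = b).
    (* An edge from [y] to [z] that avoids the centre is prolonged through [a] to a neighbour of [a]
       other than [y]: here [c], below [b]. *)
    by apply: (noP4 c a y z) => //; [exact: adj_sym | rewrite yb | exact: nesym].
  by apply: (noP4 b a y z) => //; [exact: adj_sym | exact: nesym | exact: nesym].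
apply: (star_of_center tG (adj_sym ab)) => y z by_ yz.
apply: contrapT => zb; have [ya|ya] := pselect (y = a).
  by apply: onlyb; exists z; rewrite -ya.
by apply: (noP4 a b y z) => //; exact: nesym.
Qed.

End Graphs.

Section Spectrum.
Set Implicit Arguments.
Unset Strict Implicit.
Local Open Scope ring_scope.
Variables (R : comNzRingType) (M : lmodType R).
Implicit Types (N L K H : set M) (T : set (set M)).

Lemma proper_submoduleI N H :
  proper_submodule N -> proper_submodule H -> proper_submodule (N `&` H).
Proof.
move=> [[N0 Nl] NT] [[H0 Hl] _]; split; last first.
  by move=> NHT; apply: NT; apply/seteqP; split=> // x _;
     have [] : (N `&` H) x by rewrite NHT.
split=> [|r u v]; first by apply/mem_set; split; apply/set_mem.
move=> /set_mem[Nu Hu] /set_mem[Nv Hv]; apply/mem_set; split; apply/set_mem.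
  by apply: Nl; apply/mem_set.
by apply: Hl; apply/mem_set.
Qed.

Lemma V_setI N H : V (N `&` H) = V N `|` V H.
Proof.
apply/seteqP; split=> [P [[Pp prP] NHP]|P [] [sP NP]]; last 2 first.
- by split=> // r rNH; apply: NP => m; case: (rNH m).
- by split=> // r rNH; apply: NP => m; case: (rNH m).
have [NP|nNP] := pselect (colon N `<=` colon P); first by left.
right; split=> // s sH; apply: contrapT => sP; apply: nNP => r rN.
apply: contrapT => rP; apply: sP => m.
(* With [r] in (N:M) and [s] in (H:M), the product carries M into both N and H. Primeness of P,
   applied to r(sm) with [r] outside (P:M), then puts each sm in P. *)
have rsP : colon P (r * s).
  apply: NHP => e; split; [|rewrite mulrC]; rewrite -scalerA.
    exact: rN.
  exact: sH.
by have := rsP m; rewrite -scalerA => /prP[].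
Qed.

(** Each endpoint witnesses that the other is a vertex, and equal endpoints would force
    [V N = T]. *)
Lemma tau_adjP T N K : tau_adj T N K <->
  [/\ proper_submodule N, proper_submodule K, V N <> T, V K <> T
    & V N `|` V K = T].
Proof.
split=> [[[pN [? [_ _ VN _]]] [pK [? [_ _ VK _]]] _ VNK] //|[pN pK VN VK VNK]].
split=> //.
- by split=> //; exists K.
- by split=> //; exists N; split; rewrite // setUC.
- by move=> NK; apply: VK; rewrite -VNK NK setUid.
Qed.

Lemma tau_no_path4 T N L K H : graph_acyclic (G_tau T) ->
  tau_adj T N L -> tau_adj T L K -> tau_adj T K H -> N <> K -> L <> H -> False.
Proof.
move=> acG NL LK KH NK LH.
have /tau_adjP[pN pL VN VL VNL] := NL.
have /tau_adjP[_ pK _ VK VLK] := LK.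
have /tau_adjP[_ pH _ VH VKH] := KH.
have [VNH|VNH] := pselect (V H `|` V N = T).
  by apply: (@acyclic_no_square _ _ N L K H acG) => //; apply/tau_adjP.
have pI := proper_submoduleI pN pH.
have VI : V (N `&` H) <> T by rewrite V_setI setUC.
(* Both sets lie in T, so the extra term of V(N) [|] V(H) is absorbed when the union with V(L) or
   V(K) is already T. *)
have VHsub : V H `<=` T by rewrite -VKH; exact: subsetUr.
have VNsub : V N `<=` T by rewrite -VNL; exact: subsetUl.
apply: (@acyclic_no_triangle _ _ (N `&` H) L K acG) => //; apply/tau_adjP; split=> //.
- by rewrite V_setI setUAC VNL; apply/setUidPl.
- by rewrite V_setI setUCA VKH; apply/setUidPr.
Qed.

End Spectrum.

Theorem theorem3p5 (R : comNzRingType) (M : lmodType R) (T : set (set M))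
    (T_neq0 : T !=set0) (T_Spec : T `<=` Spec M) :
  is_tree (G_tau T) -> is_star (G_tau T).
Proof.
move=> tG; have [[N [pN [K [pK VNK VN VK]]]] _ acG] := tG.
(* A tree has a vertex, and the witness that makes it one is its neighbour, so there is an edge. *)
have NK : adj (G_tau T) N K by apply/tau_adjP.
by apply: (star_of_no_path4 tG NK) => x y z t; exact: tau_no_path4.
Qed.
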